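(* For all $n \ge 12$ divisible by $4$, $$\delta(n,4,2) \le \frac{n^2}{4} - \frac{5n}{4} - \frac{\sqrt{n-3}}{2} + \frac{3}{2}.$$ Furthermore, there are infinitely many values of $n$ (divisible by $4$) such that, for some integer $t$, $$\delta(n,4,2) = \delta_2\big(\overline{\mathcal{B}}_{n,4}(t)\big) = \frac{n^2}{4} - \frac{5n}{4} - \frac{\sqrt{n-3}}{2} + \frac{3}{2}$$ and $\overline{\mathcal{B}}_{n,4}(t)$ does not contain a perfect matching.
   Context: A perfect matching in a hypergraph $H$ is a collection of vertex-disjoint edges of $H$ covering $V(H)$. For a hypergraph $H$, $\delta_2(H)$ is the minimum, over all $2$-element sets $S$ of vertices, of the number of edges of $H$ containing $S$. Let $V$ be a set of $n$ vertices and let $A, B$ be a partition of $V$ into non-empty sets (the order of $A,B$ matters). $\mathcal{B}_{n,k}(A,B)$ is the $k$-uniform hypergraph on $V=A\cup B$ whose edges are all $k$-subsets of $V$ meeting $A$ in an odd number of vertices; $\overline{\mathcal{B}}_{n,k}(A,B)$ is its complement, whose edges are all $k$-subsets of $V$ meeting $A$ in an even number of vertices. For an integer $t$ with $-\lfloor n/2\rfloor < t < \lceil n/2\rceil$, $\mathcal{B}_{n,k}(t)$ denotes $\mathcal{B}_{n,k}(A,B)$ with $|A| = \lfloor n/2\rfloor + t$ and $|B| = \lceil n/2\rceil - t$, and $\overline{\mathcal{B}}_{n,k}(t)$ denotes its complement. For $k\ge 2$ with $k$ dividing $n$, $\mathcal{H}_{\text{ext}}(n,k)$ is the collection consisting of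 the following hypergraphs: all $\overline{\mathcal{B}}_{n,k}(A,B)$ with $|A|$ odd; if $n/k$ is odd, additionally all $\mathcal{B}_{n,k}(A,B)$ with $|A|$ even; if $n/k$ is even, additionally all $\mathcal{B}_{n,k}(A,B)$ with $|A|$ odd. $\delta(n,4,2)$ denotes the maximum of $\delta_2(F)$ over all $F\in\mathcal{H}_{\text{ext}}(n,4)$. *)

(* Defs.v *)
From mathcomp Require Import all_boot all_order all_algebra.

Set Implicit Arguments.
Unset Strict Implicit.
Unset Printing Implicit Defensive.

Import Order.TTheory GRing.Theory Num.Theory.

(* A hypergraph on the vertex type T is given by its set of edges. *)
Definition hypergraph (T : finType) := {set {set T}}.

Definition degree (T : finType) (H : hypergraph T) (S : {set T}) : nat :=
  #|[set e in H | S \subset e]|.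

(* No degree exceeds #|H|, so #|H| is neutral for the minimum as soon as T
   has an l-element subset. *)
Definition min_degree (T : finType) (l : nat) (H : hypergraph T) : nat :=
  \big[minn/#|H|]_(S : {set T} | #|S| == l) degree H S.

Definition perfect_matching (T : finType) (H : hypergraph T)
    (M : {set {set T}}) : bool :=
  [&& M \subset H, trivIset M & cover M == [set: T]].

Definition has_perfect_matching (T : finType) (H : hypergraph T) : Prop :=
  exists M : {set {set T}}, perfect_matching H M.

(* A partition (A, B) of T is represented by A alone, with B = ~: A. *)
Definition parts_nonempty (T : finType) (A : {set T}) : bool :=
  (A != set0) && (~: A != set0).

Definition Bodd (T : finType) (k : nat) (A : {set T}) : hypergraph T :=
  [set e : {set T} | (#|e| == k) && odd #|e :&: A|].

(* The complement of Bodd k A among k-uniform hypergraphs. *)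
Definition Beven (T : finType) (k : nat) (A : {set T}) : hypergraph T :=
  [set e : {set T} | (#|e| == k) && ~~ odd #|e :&: A|].

(* The initial segment of 'I_n of size n./2 + t, which is a non-empty proper
   subset when - n./2 < t < uphalf n; B(A, B) depends only on #|A| up to
   isomorphism. *)
Definition initial_part (n : nat) (t : int) : {set 'I_n} :=
  [set i : 'I_n | ((i : nat)%:Z < n./2%:Z + t)%R].

Definition Beven_shift (n k : nat) (t : int) : hypergraph 'I_n :=
  Beven k (initial_part n t).

Definition Hext (n k : nat) : {set hypergraph 'I_n} :=
  [set Beven k A | A : {set 'I_n} & parts_nonempty A && odd #|A|] :|:
  (if odd (n %/ k)
   then [set Bodd k A | A : {set 'I_n} & parts_nonempty A && ~~ odd #|A|]
   else [set Bodd k A | A : {set 'I_n} & parts_nonempty A && odd #|A|]).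

Definition delta_ext (n k l : nat) : nat :=
  \max_(F in Hext n k) min_degree l F.

(* Main.v *)
Require Import Defs.
From mathcomp Require Import all_boot all_order all_algebra.
From mathcomp Require Import zify ring lra.

Import Order.TTheory GRing.Theory Num.Theory.

(** Let [A], [B] partition the [n] vertices with [#|A| = n/2 + t] and
    [#|B| = n/2 - t], where [t >= 0] after exchanging the two parts if needed
    ([Bparity_setC]).  A pair of vertices is completed to an edge by two more
    vertices whose parity in [A] is prescribed, so its degree depends only on
    how the pair meets [A] ([degree_Bparity]).  The degrees that matter are
      [f u = (n/2 - 1)^2 - u^2]  and  [g u = (n/2 - 1)(n/2 - 2) + (u - 1)^2],
    with [u = t] in the even hypergraph (a mixed pair, a pair inside [A]) and
    [u = t + 1] in the odd one (a pair inside [B], a mixed pair).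

    Put [r = sqrt (n - 3)].  The decreasing function [f] and the parabola [g]
    meet at [u = (r + 1)/2], where their common value is exactly the stated
    bound.  To the right of that point [f] is below the bound.  On the
    interval from [(3 - r)/2] to [(r + 1)/2], which is symmetric about the
    vertex [1] of [g], it is [g] that is below the bound, and [n >= 12] says
    [r >= 3], so that this interval reaches down to [0].  Hence
    [min (f u) (g u)] never exceeds the bound ([min_le_extremal_bound]).

    Equality holds when the crossing point is an admissible [t]: for
    [r = 2p + 3] it is [t = p + 2], and [n = r^2 + 3] is divisible by [4].  For
    odd [p] the part [A] is odd, so the even hypergraph of [A] is one of the
    extremal ones, and it has no perfect matching because its edges all meet
    [A] evenly ([Beven_no_perfect_matching]). *)

(** * Degrees of pairs *)

(** A common form of [Bodd] ([c = true]) and [Beven] ([c = false]), so that one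
    count of degrees serves both. *)
Definition Bparity {T : finType} (k : nat) (c : bool) (A : {set T}) :
    hypergraph T :=
  [set e : {set T} | (#|e| == k) && (odd #|e :&: A| == c)].

Lemma Beven_parity (T : finType) k (A : {set T}) : Beven k A = Bparity k false A.
Proof. by apply/setP => e; rewrite !inE eqbF_neg. Qed.

Lemma Bodd_parity (T : finType) k (A : {set T}) : Bodd k A = Bparity k true A.
Proof. by apply/setP => e; rewrite !inE eqb_id. Qed.

Lemma Bparity_setC {T : finType} k c (A : {set T}) :
  ~~ odd k -> Bparity k c (~: A) = Bparity k c A.
Proof.
move=> evk; apply/setP => e; rewrite !inE; case: eqP => //= ke.
have := cardsID A e; rewrite -setDE ke => h.
have : ~~ odd (#|e :&: A| + #|e :\: A|) by rewrite h.
by rewrite oddD; do 2 case: (odd _).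
Qed.

(** Such an [e] is [S] together with an [i]-subset of [A :\: S] and a
    [j]-subset of [~: A :\: S], chosen independently. *)
Lemma card_supersets {T : finType} (A S : {set T}) i j :
  #|[set e : {set T} | [&& S \subset e, #|(e :&: A) :\: S| == i
                         & #|(e :\: A) :\: S| == j]]|
  = 'C(#|A :\: S|, i) * 'C(#|~: A :\: S|, j).
Proof.
rewrite -2!cards_draws -cardsX.
pose f (u : {set T} * {set T}) := u.1 :|: u.2 :|: S.
have fA (u : {set T} * {set T}) : u.1 \subset A :\: S ->
    u.2 \subset ~: A :\: S ->
    ((f u :&: A) :\: S = u.1) * ((f u :\: A) :\: S = u.2).
  move=> /subsetP h1 /subsetP h2; split; apply/setP => x;
  move/implyP: (h1 x); move/implyP: (h2 x); rewrite !inE;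
  by case: (x \in u.1); case: (x \in u.2); case: (x \in A); case: (x \in S).
(* The map [f] glues the two subsets to [S]; [fA] shows that it loses nothing. *)
rewrite -(@card_in_imset _ _ f); last first.
  move=> u v; rewrite !inE => /andP[/andP[u1 _] /andP[u2 _]].
  move=> /andP[/andP[v1 _] /andP[v2 _]] e.
  have [e1 e2] := fA _ u1 u2; have [e3 e4] := fA _ v1 v2.
  by rewrite [u]surjective_pairing [v]surjective_pairing -e1 -e2 -e3 -e4 e.
apply: eq_card => e; rewrite !inE; apply/idP/imsetP.
- move=> /and3P[Se ci cj].
  exists ((e :&: A) :\: S, (e :\: A) :\: S).
    rewrite !inE /= ci cj !andbT; apply/andP; split; apply/subsetP => x.
      by rewrite !inE => /and3P[-> _ ->].
    by rewrite !inE => /and3P[-> -> _].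
  apply/setP => x; move/subsetP: Se => /(_ x); rewrite !inE /=.
  by case: (x \in e); case: (x \in A); case: (x \in S) => // /(_ isT).
- move=> [u]; rewrite !inE => /andP[/andP[u1 c1] /andP[u2 c2]] ->.
  by rewrite !(fA u u1 u2) c1 c2 subsetUr.
Qed.

(** The degree of a pair with [i] vertices in a part of size [a] and [j] in the
    other part, of size [b]: the two added vertices lie in the same part when
    the pair already has the parity [c], and in different parts otherwise. *)
Definition pair_degree (c : bool) (a b i j : nat) : nat :=
  if odd i == c then 'C(a - i, 2) + 'C(b - j, 2) else (a - i) * (b - j).

Lemma degree_Bparity {T : finType} c (A S : {set T}) : #|S| = 2 ->
  degree (Bparity 4 c A) S
  = pair_degree c #|A| #|~: A| #|A :&: S| #|~: A :&: S|.
Proof.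
move=> cS; rewrite /pair_degree -!cardsD.
pose X i j := [set e : {set T} | [&& S \subset e, #|(e :&: A) :\: S| == i
                         & #|(e :\: A) :\: S| == j]].
have cX i j : #|X i j| = 'C(#|A :\: S|, i) * 'C(#|~: A :\: S|, j).
  exact: card_supersets.
have split_e (e : {set T}) : S \subset e ->
    (#|e| = 2 + (#|(e :&: A) :\: S| + #|(e :\: A) :\: S|)) *
    (#|e :&: A| = #|A :&: S| + #|(e :&: A) :\: S|).
  move=> Se; have eS : e :&: S = S by apply/setIidPr.
  split.
    rewrite -(cardsID S e) eS cS -(cardsID A (e :\: S)).
    by rewrite setIDAC !setDDl (setUC S A).
  by rewrite -(cardsID S (e :&: A)) -setIA [e :&: _]setIC -setIA (setIC S) eS.
(* The two added vertices are 2 + 0, 0 + 2 or 1 + 1 in [A] and outside it. *)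
have -> : degree (Bparity 4 c A) S =
    #|if odd #|A :&: S| == c then X 2 0 :|: X 0 2 else X 1 1|.
  apply: eq_card => e; rewrite !inE.
  rewrite (fun_if (fun Z : {set {set T}} => e \in Z)) !inE.
  case: (boolP (S \subset e)) => Se; last by rewrite andbF /=; case: ifP.
  rewrite !(split_e e Se) andbT oddD.
  move: #|_ :\: _| #|(e :\: A) :\: S| => p q.
  case: (odd _); case: c => /=; lia.
case: ifP => _; last by rewrite cX !bin1.
rewrite cardsU (_ : _ :&: _ = set0) ?cards0 ?subn0; last first.
  by apply/setP => e; rewrite !inE; lia.
by rewrite !cX !bin0 muln1 mul1n.
Qed.

(** With [S] empty, [card_supersets] counts these sets by a positive product of
    binomial coefficients. *)
Lemma exists_split_set {T : finType} {A : {set T}} {i j} :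
  i <= #|A| -> j <= #|~: A| ->
  exists S : {set T}, [/\ #|A :&: S| = i, #|~: A :&: S| = j & #|S| = i + j].
Proof.
move=> iA jA.
have := card_supersets A set0 i j; rewrite !setD0 => h.
have : 0 < 'C(#|A|, i) * 'C(#|~: A|, j) by rewrite muln_gt0 !bin_gt0 iA.
rewrite -h card_gt0 => /set0Pn[S].
rewrite inE sub0set !setD0 => /and3P[_ /eqP ci /eqP cj].
exists S; split; first by rewrite setIC.
  by rewrite setIC -setDE.
by rewrite -(cardsID A S) ci cj.
Qed.

Lemma min_degree_le {T : finType} {l} {H : hypergraph T} {S : {set T}} :
  #|S| = l -> min_degree l H <= degree H S.
Proof.
by move=> /eqP cS; rewrite -leEnat /min_degree -minEnat; apply: bigmin_le_cond.
Qed.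

(** The bound [l <= #|T|] provides at least one [l]-set, whose degree shows that
    the default value [#|H|] of the minimum is also at least [m]. *)
Lemma le_min_degree (T : finType) l (H : hypergraph T) m :
  l <= #|T| -> (forall S : {set T}, #|S| = l -> m <= degree H S) ->
  m <= min_degree l H.
Proof.
move=> lT mS; rewrite /min_degree.
elim/big_ind: _ => [|x y mx my|S /eqP/mS//]; last by rewrite leq_min mx.
have [S [_ cS]] : exists S : {set T}, S \subset [set: T] /\ #|S| = l.
  have : 0 < 'C(#|[set: T]|, l) by rewrite bin_gt0 cardsT.
  rewrite -cards_draws card_gt0 => /set0Pn[S]; rewrite inE => /andP[? /eqP].
  by exists S.
apply: leq_trans (mS S cS) _; apply/subset_leq_card/subsetP => e.
by rewrite inE => /andP[].
Qed.

(** * The upper bound *)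

Lemma bin2_double (x : nat) : 'C(x, 2) * 2 + x = x * x.
Proof. by elim: x => // x IHx; rewrite binS bin1; lia. Qed.

Section RealBounds.
Variable R : rcfType.
Local Open Scope ring_scope.

Lemma natr_bin2 (x : nat) : ('C(x, 2))%:R = x%:R * (x%:R - 1) / 2 :> R.
Proof.
have /(congr1 (fun y => y%:R : R)) := bin2_double x.
by rewrite natrD !natrM => h; lra.
Qed.

Lemma natr_pair_degree c (a b i j : nat) : (i <= a)%N -> (j <= b)%N ->
  (pair_degree c a b i j)%:R =
  if odd i == c then
    ((a%:R - i%:R) * (a%:R - i%:R - 1) + (b%:R - j%:R) * (b%:R - j%:R - 1)) / 2
  else (a%:R - i%:R) * (b%:R - j%:R) :> R.
Proof.
move=> ia jb; rewrite /pair_degree; case: ifP => _.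
  by rewrite natrD !natr_bin2 !natrB //; field.
by rewrite natrM !natrB.
Qed.

Definition extremal_bound (x : R) : R :=
  x ^+ 2 / 4 - 5 * x / 4 - Num.sqrt (x - 3) / 2 + 3 / 2.

(** With [r = sqrt (x - 3)] the bound is the value at [u = (r + 1) / 2] of
    [(x / 2 - 1) ^+ 2 - u ^+ 2]. *)
Lemma extremal_boundE {x : R} : 12 <= x ->
  exists r : R, [/\ 3 <= r, x = r ^+ 2 + 3 &
    extremal_bound x = (x / 2 - 1) ^+ 2 - ((r + 1) / 2) ^+ 2].
Proof.
move=> x12; exists (Num.sqrt (x - 3)).
have r2 : Num.sqrt (x - 3) ^+ 2 = x - 3 by rewrite sqr_sqrtr //; lra.
have r0 : 0 <= Num.sqrt (x - 3) by exact: sqrtr_ge0.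
split; [nra | lra |].
rewrite /extremal_bound; set r := Num.sqrt _ in r2 r0 *.
have -> : x = r ^+ 2 + 3 by lra.
by field.
Qed.

(** The two upper bounds on [m] are equal at [u = (r + 1) / 2], and the first
    one decreases with [u].  Below that point the second one applies:
    [3 <= r] gives [`|u - 1| <= (r - 1) / 2] for all [u] down to [0]. *)
Lemma min_le_extremal_bound {x : R} (u : R) {m : R} : 12 <= x -> 0 <= u ->
  m <= (x / 2 - 1) ^+ 2 - u ^+ 2 ->
  m <= (x / 2 - 1) * (x / 2 - 2) + (u - 1) ^+ 2 ->
  m <= extremal_bound x.
Proof.
move=> x12 u0 m1 m2; have [r [r3 xr ->]] := extremal_boundE x12.
have [ur|ur] := lerP ((r + 1) / 2) u.
  apply: le_trans m1 _; nra.
apply: le_trans m2 _; rewrite xr; nra.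
Qed.

(** Two kinds of pairs give the two inequalities of [min_le_extremal_bound]:
    for even edges a mixed pair and a pair in the larger part, for odd edges a
    pair in the smaller part, if it has two vertices, and a mixed pair. *)
Lemma min_degree_Bparity_le {T : finType} c (A : {set T}) :
  (12 <= #|T|)%N -> parts_nonempty A ->
  (min_degree 2 (Bparity 4 c A))%:R <= extremal_bound #|T|%:R.
Proof.
move=> n12; wlog leBA : A / (#|~: A| <= #|A|)%N => [hw nA|].
  have [|/ltnW] := leqP #|~: A| #|A|; first by move=> /hw; apply.
  rewrite -{1}[A]setCK => /hw; rewrite Bparity_setC //; apply.
  by move: nA; rewrite /parts_nonempty setCK andbC.
move=> /andP[_ B0].
have b1 : (0 < #|~: A|)%N by rewrite card_gt0.
have nE := cardsC A.
have le_deg i j : (i <= #|A|)%N -> (j <= #|~: A|)%N -> (i + j = 2)%N ->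
    (min_degree 2 (Bparity 4 c A))%:R <=
      (pair_degree c #|A| #|~: A| i j)%:R :> R.
  move=> iA jA ij; have [S [Si Sj]] := exists_split_set iA jA.
  rewrite ij => cS; rewrite ler_nat -Si -Sj -degree_Bparity //.
  exact: min_degree_le.
have x12 : 12 <= #|T|%:R :> R by rewrite ler_nat.
have xE : #|T|%:R = #|A|%:R + #|~: A|%:R :> R by rewrite -natrD nE.
have le11 := le_deg 1 1 ltac:(lia) b1 erefl.
have le20 := le_deg 2 0 ltac:(lia) (leq0n _) erefl.
have le02 := fun h => le_deg 0 2 (leq0n _) h erefl.
rewrite natr_pair_degree in le11; [|lia..].
rewrite natr_pair_degree in le20; [|lia..].
have abR : #|~: A|%:R <= #|A|%:R :> R by rewrite ler_nat.
move: le11 le20 le02 xE x12 abR.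
set m := _%:R; set x := #|T|%:R.
case: c @m {le_deg} => m /= le11 le20 le02 xE x12 abR; last first.
  apply: (min_le_extremal_bound ((#|A|%:R - #|~: A|%:R) / 2)) => //.
  - lra.
  - apply: le_trans le11 _; rewrite xE; lra.
  - apply: le_trans le20 _; rewrite xE; lra.
have [b2|b2] := leqP 2 #|~: A|.
  have := le02 b2; rewrite natr_pair_degree //= => {}le02.
  apply: (min_le_extremal_bound ((#|A|%:R - #|~: A|%:R) / 2 + 1)) => //.
  - lra.
  - apply: le_trans le02 _; rewrite xE; lra.
  - apply: le_trans le11 _; rewrite xE; lra.
(* A smaller part with one vertex contains no pair; then a pair inside [A] has
   degree only [#|T| - 3]. *)
have bE : #|~: A| = 1%N by lia.
rewrite bE in le20 xE.
apply: le_trans le20 _.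
have [r [r3 xr ->]] := extremal_boundE x12.
have -> : #|A|%:R = x - 1 by lra.
rewrite xr; nra.
Qed.

Lemma delta_ext_le (n : nat) : (12 <= n)%N ->
  (delta_ext n 4 2)%:R <= extremal_bound n%:R.
Proof.
move=> n12; rewrite /delta_ext.
elim/big_ind: _ => [|x y hx hy|F].
(* The default value [0] of the maximum must lie below the bound too. *)
- have x12 : 12 <= n%:R :> R by rewrite ler_nat.
  have [r [r3 xr ->]] := extremal_boundE x12; rewrite xr; nra.
- by rewrite /maxn; case: ifP.
have hB c (A : {set 'I_n}) : parts_nonempty A ->
    (min_degree 2 (Bparity 4 c A))%:R <= extremal_bound n%:R.
  by move=> nA; have := @min_degree_Bparity_le _ c A; rewrite card_ord; apply.
rewrite /Hext in_setU => /orP[/imsetP[A]|].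
  by rewrite inE => /andP[nA _] ->; rewrite Beven_parity; apply: hB.
by case: ifP => _ /imsetP[A]; rewrite inE => /andP[nA _] ->;
  rewrite Bodd_parity; apply: hB.
Qed.

End RealBounds.

(** * The extremal hypergraphs *)

(** A perfect matching would split [A] into sets of even size. *)
Lemma Beven_no_perfect_matching {T : finType} k (A : {set T}) :
  odd #|A| -> ~ has_perfect_matching (Beven k A).
Proof.
move=> oA [M /and3P[/subsetP MH tM cM]].
have cA : #|A| = \sum_(e in M) #|e :&: A|.
  have := @big_trivIset _ _ 0 addn M (fun x => (x \in A) : nat) tM.
  rewrite (eqP cM) => /= h.
  transitivity (\sum_(x in [set: T]) (x \in A : nat)).
    rewrite -sum1_card big_mkcond [RHS]big_mkcond.
    by apply: eq_bigr => x _; rewrite inE; case: (x \in A).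
  rewrite h; apply: eq_bigr => e _.
  rewrite -sum1_card big_mkcond [RHS]big_mkcond.
  by apply: eq_bigr => x _; rewrite inE; case: (x \in e); case: (x \in A).
move: oA; rewrite cA; apply/negP.
elim/big_ind: _ => // [x y|e /MH]; first by rewrite oddD => /negPf-> /negPf->.
by rewrite inE => /andP[].
Qed.

Lemma card_initial_part (n : nat) (t : nat) : n./2 + t <= n ->
  #|initial_part n t%:Z| = n./2 + t.
Proof.
move=> le_n; rewrite -sum1_card.
have := big_ord_narrow (idx := 0) (op := addn) (F := fun=> 1) le_n.
rewrite [X in _ = X]sum1_card card_ord => <-.
by apply: eq_bigl => i; rewrite inE -PoszD ltz_nat.
Qed.

(** The sizes are [n/2 + t] and [n/2 - t] for [n = (2p + 3)^2 + 3] and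
    [t = p + 2], the choice for which mixed pairs and pairs inside [A] have the
    same degree; pairs inside [~: A] have a larger one. *)
Lemma min_degree_Beven_extremal {T : finType} {A : {set T}} (p : nat) :
  #|A| = 2 * (p * p) + 7 * p + 8 -> #|~: A| = 2 * (p * p) + 5 * p + 4 ->
  min_degree 2 (Beven 4 A) = #|A|.-1 * #|~: A|.-1.
Proof.
move=> cA cB; rewrite Beven_parity; apply/eqP; rewrite eqn_leq.
apply/andP; split.
  have [S [Si Sj cS]] := @exists_split_set T A 1 1 ltac:(lia) ltac:(lia).
  apply: leq_trans (min_degree_le cS) _.
  by rewrite degree_Bparity // Si Sj /pair_degree /= !subn1.
apply: le_min_degree => [|S cS]; first by rewrite -(cardsC A); lia.
have : #|A :&: S| + #|~: A :&: S| = 2.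
  by rewrite ![_ :&: S]setIC -setDE cardsID.
rewrite degree_Bparity // {}cA {}cB /pair_degree.
move: #|A :&: S| #|~: A :&: S| => i j ij.
have a1E : (2 * (p * p) + 7 * p + 8).-1 = 2 * (p * p) + 7 * p + 7 by lia.
have b1E : (2 * (p * p) + 5 * p + 4).-1 = 2 * (p * p) + 5 * p + 3 by lia.
have [[-> ->]|[[-> ->]|[-> ->]]] /= :
    (i = 0 /\ j = 2) \/ (i = 1 /\ j = 1) \/ (i = 2 /\ j = 0) by lia.
- rewrite a1E b1E; have := bin2_double (2 * (p * p) + 7 * p + 8 - 0).
  have := bin2_double (2 * (p * p) + 5 * p + 4 - 2).
  have -> : 2 * (p * p) + 5 * p + 4 - 2 = 2 * (p * p) + 5 * p + 2 by lia.
  rewrite subn0; lia.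
- by rewrite !subn1.
- rewrite a1E b1E; have := bin2_double (2 * (p * p) + 7 * p + 8 - 2).
  have := bin2_double (2 * (p * p) + 5 * p + 4 - 0).
  have -> : 2 * (p * p) + 7 * p + 8 - 2 = 2 * (p * p) + 7 * p + 6 by lia.
  rewrite subn0; lia.
Qed.

Theorem fact5p11 (R : rcfType) :
  (forall n : nat, 12 <= n -> 4 %| n ->
     ((delta_ext n 4 2)%:R <=
        n%:R ^+ 2 / 4 - 5 * n%:R / 4 - Num.sqrt (n%:R - 3) / 2 + 3 / 2 :> R)%R)
  /\
  (forall N : nat, exists n : nat,
     [/\ N < n, 4 %| n &
         exists t : int,
           [/\ (- n./2%:Z < t < (uphalf n)%:Z)%R,
               delta_ext n 4 2 = min_degree 2 (Beven_shift n 4 t),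
               ((min_degree 2 (Beven_shift n 4 t))%:R =
                  n%:R ^+ 2 / 4 - 5 * n%:R / 4
                    - Num.sqrt (n%:R - 3) / 2 + 3 / 2 :> R)%R
             & ~ has_perfect_matching (Beven_shift n 4 t)]]).
Proof.
split=> [n n12 _|N]; first exact: delta_ext_le.
(* Here [n = (2p + 3)^2 + 3] and [t = p + 2]; [p] is odd to make [#|A|] odd. *)
have [p [Np op]] : exists p, N < p /\ odd p by exists (2 * N + 1); lia.
pose n := 4 * (p * p + 3 * p + 3).
have halfE : n./2 = 2 * (p * p) + 6 * p + 6 by rewrite /n; lia.
have uphalfE : uphalf n = n./2 by rewrite /n; lia.
pose A := initial_part n p.+2.
have cA : #|A| = 2 * (p * p) + 7 * p + 8.
  by rewrite card_initial_part halfE /n; lia.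
have cB : #|~: A| = 2 * (p * p) + 5 * p + 4.
  by have := cardsC A; rewrite card_ord cA /n; lia.
have oA : odd #|A| by rewrite cA; lia.
have mE := min_degree_Beven_extremal p cA cB.
have boundE : ((min_degree 2 (Beven 4 A))%:R = extremal_bound R n%:R :> R)%R.
  have rE : (n%:R - 3 = (2 * p%:R + 3) ^+ 2 :> R)%R.
    by rewrite /n natrM !natrD !natrM; ring.
  rewrite mE cA cB /extremal_bound rE sqrtr_sqr ger0_norm; last first.
    by rewrite addr_ge0 // mulr_ge0.
  have -> : (n%:R = (2 * p%:R + 3) ^+ 2 + 3 :> R)%R by lra.
  have -> : (2 * (p * p) + 7 * p + 8).-1 = 2 * (p * p) + 7 * p + 7 by lia.
  have -> : (2 * (p * p) + 5 * p + 4).-1 = 2 * (p * p) + 5 * p + 3 by lia.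
  by rewrite natrM !natrD !natrM; field.
exists n; split.
- by rewrite /n; lia.
- by rewrite /n dvdn_mulr.
exists (Posz p.+2); split; [lia | | exact: boundE | exact: Beven_no_perfect_matching].
apply/eqP; rewrite eqn_leq; apply/andP; split.
  rewrite -(ler_nat R) [leRHS]boundE; apply: delta_ext_le; rewrite /n; lia.
apply: (@leq_bigmax_cond _ (fun F => F \in Hext n 4) (fun F => min_degree 2 F)).
rewrite in_setU; apply/orP; left; apply/imsetP; exists A => //.
by rewrite inE oA andbT /parts_nonempty -!card_gt0 cA cB; lia.
Qed.
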